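(* Let $P$ and $Q$ be rational $d$-polytopes in $\mathbb R^d$. If $\mathrm{ehr}_{P+\bm v}(t)=\mathrm{ehr}_{Q+\bm v}(t)$ for all $\bm v\in\mathbb Q^d$ and all $t\in\mathbb Z_{\ge0}$, then $P=Q+\bm u$ for some $\bm u\in\mathbb Z^d$. Equivalently: if $\mathrm{TL}_{P,\bm v}(t)=\mathrm{TL}_{Q,\bm v}(t)$ for all $\bm v\in\mathbb R^d$ and $t\in\mathbb Z_{\ge0}$, then $P=Q+\bm w$ for some $\bm w\in\mathbb Z^d$.
   Context: $\mathrm{ehr}_X(t)=\#(tX\cap\mathbb Z^d)$ and $\mathrm{TL}_{X,\bm v}(t)=\#((tX+\bm v)\cap\mathbb Z^d)$ for $t\in\mathbb Z_{\ge0}$; $X+\bm v=\{\bm x+\bm v:\bm x\in X\}$. *)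

(* Defs.v *)
From HB Require Import structures.
From mathcomp Require Import all_boot all_order all_algebra.
From mathcomp Require Import finmap.
From mathcomp Require Import classical_sets cardinality reals.
Set Implicit Arguments. Unset Strict Implicit. Unset Printing Implicit Defensive.
Import Order.TTheory GRing.Theory Num.Theory.
Local Open Scope ring_scope.
Local Open Scope classical_set_scope.

Definition conv (R : realType) (d : nat) (V : seq 'rV[R]_d) : set 'rV[R]_d :=
  [set x | exists w : 'I_(size V) -> R,
     (forall i, 0 <= w i) /\ \sum_(i < size V) w i = 1 /\
     x = \sum_(i < size V) w i *: V`_i].

Definition rat_point (R : realType) (d : nat) (x : 'rV[R]_d) : Prop :=
  exists q : 'rV[rat]_d, x = map_mx (fun r => ratr r) q.

Definition lattice_point (R : realType) (d : nat) (x : 'rV[R]_d) : Prop :=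
  exists z : 'rV[int]_d, x = map_mx (fun k => k%:~R) z.

Definition full_dim (R : realType) (d : nat) (X : set 'rV[R]_d) : Prop :=
  exists c : 'rV[R]_d, exists e : R, 0 < e /\
    forall y : 'rV[R]_d, (forall i, `|y 0 i - c 0 i| < e) -> X y.

Definition rational_dpolytope (R : realType) (d : nat) (P : set 'rV[R]_d) :=
  (exists V : seq 'rV[R]_d, (forall x, x \in V -> rat_point x) /\ P = conv V)
  /\ full_dim P.

Definition translate (R : realType) (d : nat) (X : set 'rV[R]_d) (v : 'rV[R]_d)
  : set 'rV[R]_d := [set x + v | x in X].

Definition dilate (R : realType) (d : nat) (t : nat) (X : set 'rV[R]_d)
  : set 'rV[R]_d := [set t%:R *: x | x in X].

Definition ehr (R : realType) (d : nat) (X : set 'rV[R]_d) (t : nat) : nat :=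
  #|` fset_set [set z : 'rV[int]_d | dilate t X (map_mx (fun k => k%:~R) z)] |%fset.

(* Main.v *)
Require Import Defs.
From HB Require Import structures.
From mathcomp Require Import all_boot all_order all_algebra.
From mathcomp Require Import finmap.
From mathcomp Require Import boolp classical_sets cardinality reals.
From mathcomp Require Import ring lra zify.
Set Implicit Arguments. Unset Strict Implicit. Unset Printing Implicit Defensive.
Import Order.TTheory GRing.Theory Num.Theory.
Local Open Scope ring_scope.
Local Open Scope classical_set_scope.

(* For a polytope P let N_P(x) be the number of lattice points z with z + x in
   P, and suppose N_P = N_Q at rational points.  The Euler characteristic turns
   this into the same identity for the faces of P and Q in any rational
   direction xi: near a point p, the slice xi = delta > 0 of P - p is nonempty
   exactly when p lies in P but not on its face in direction xi.  By induction
   on the number of generators those faces are lattice translates of each other,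
   so the difference D of the support functions is linear near every xi that is
   not constant on both polytopes.  After a lattice translation D vanishes near
   some xi0, hence along each segment from xi0 that avoids the functionals
   constant on both; this forces D to have a constant sign, so one polytope
   contains the other, and N_P = N_Q excludes strict inclusion. *)

(** * Convex hulls of finite lists *)

Section Hull.
Variables (F : realFieldType) (d : nat).
Implicit Types (x y z xi : 'rV[F]_d) (V W : seq 'rV[F]_d).

Definition dot x y : F := \sum_j x 0 j * y 0 j.

Lemma dotC x y : dot x y = dot y x.
Proof. by apply: eq_bigr => j _; rewrite mulrC. Qed.

Lemma dotDr x y z : dot x (y + z) = dot x y + dot x z.
Proof. by rewrite -big_split; apply: eq_bigr => j _; rewrite mxE mulrDr. Qed.

Lemma dotZr a x y : dot x (a *: y) = a * dot x y.
Proof. by rewrite big_distrr; apply: eq_bigr => j _; rewrite mxE mulrCA. Qed.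

Lemma dotDl x y z : dot (x + y) z = dot x z + dot y z.
Proof. by rewrite dotC dotDr !(dotC z). Qed.

Lemma dotZl a x y : dot (a *: x) y = a * dot x y.
Proof. by rewrite dotC dotZr dotC. Qed.

Lemma dotNr x y : dot x (- y) = - dot x y.
Proof. by rewrite -scaleN1r dotZr mulN1r. Qed.

Lemma dotNl x y : dot (- x) y = - dot x y.
Proof. by rewrite dotC dotNr dotC. Qed.

Lemma dot0r x : dot x 0 = 0.
Proof. by rewrite -(scale0r 0) dotZr mul0r. Qed.

Lemma dot_sqr_gt0 x : x != 0 -> 0 < dot x x.
Proof.
move=> xn0; rewrite lt_neqAle eq_sym; apply/andP; split; last first.
  by apply: sumr_ge0 => j _; rewrite -expr2 sqr_ge0.
apply: contra xn0; rewrite /dot psumr_eq0 => [/allP h|j _]; last first.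
  by rewrite -expr2 sqr_ge0.
apply/eqP/rowP => j; rewrite mxE; apply/eqP.
by have := h j (mem_index_enum _); rewrite mulf_eq0 orbb.
Qed.

Lemma dot_delta j x : dot (delta_mx 0 j) x = x 0 j.
Proof.
rewrite /dot (bigD1 j) //= mxE !eqxx mul1r big1 ?addr0 // => k kj.
by rewrite mxE eqxx (negbTE kj) mul0r.
Qed.

Definition dotE := (dotDr, dotDl, dotNr, dotNl, dotZr, dotZl, dot0r).

(** Two-point combinations give an induction principle free of weight sums; [convE] recovers the
    weighted form. Stated over any [realFieldType], the theory serves both [rat] and the reals. *)
Inductive hull V : 'rV[F]_d -> Prop :=
| hull_mem v of v \in V : hull V v
| hull_conv t x y of 0 <= t & t <= 1 & hull V x & hull V y :
    hull V (t *: x + (1 - t) *: y).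

Lemma hull_sub V W : (forall v, v \in V -> hull W v) ->
  forall x, hull V x -> hull W x.
Proof.
move=> VW x; elim=> [v /VW//|t y z t0 t1 _ hy _ hz].
exact: hull_conv.
Qed.

Lemma hull_nil x : ~ hull [::] x.
Proof. by elim. Qed.

Lemma hull_exists V x : hull V x -> exists v, v \in V.
Proof. by elim=> [v vV|//]; exists v. Qed.

Lemma hull_lt V xi c : (forall v, v \in V -> dot xi v < c) ->
  forall x, hull V x -> dot xi x < c.
Proof.
move=> Vc x; elim=> [v /Vc//|t y z t0 t1 _ hy _ hz].
have t1' : 0 <= 1 - t by lra.
rewrite !dotE; have [->|tn0] := eqVneq t 0; first by lra.
have tgt : 0 < t by rewrite lt_neqAle eq_sym tn0.
by have := ler_wpM2l t1' (ltW hz); have := ltr_pM2l tgt (dot xi y) c; rewrite hy; lra.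
Qed.

Lemma hull_le V xi c : (forall v, v \in V -> dot xi v <= c) ->
  forall x, hull V x -> dot xi x <= c.
Proof.
move=> Vc x; elim=> [v /Vc//|t y z t0 t1 _ hy _ hz].
by rewrite !dotE; nra.
Qed.

Lemma hull_translate V u x : hull V x -> hull [seq v + u | v <- V] (x + u).
Proof.
elim=> [v vV|t y z t0 t1 _ hy _ hz].
  by apply/hull_mem/map_f.
have -> : t *: y + (1 - t) *: z + u = t *: (y + u) + (1 - t) *: (z + u).
  by apply/rowP => j; rewrite !mxE; ring.
exact: hull_conv.
Qed.

Lemma hull_translateE V u x : hull [seq v + u | v <- V] x <-> hull V (x - u).
Proof.
split=> [h|/(hull_translate u)]; last by rewrite subrK.
have := hull_translate (- u) h; rewrite -map_comp.
by rewrite (eq_map (g := id)) ?map_id // => v /=; rewrite addrK.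
Qed.

(** This is the elimination of one unknown in Fourier-Motzkin style: [c] is the midpoint between the
    largest lower and the smallest upper bound, or one unit beyond the other bound when one list is
    empty. *)
Lemma between (A B : seq F) : (forall a b, a \in A -> b \in B -> a < b) ->
  exists c, (forall a, a \in A -> a < c) /\ (forall b, b \in B -> c < b).
Proof.
have lub (A' : seq F) : exists m, (A' = [::] \/ m \in A') /\ forall a, a \in A' -> a <= m.
  elim: A' => [|a A' [m [mA mP]]]; first by exists 0; split=> //; left.
  have [am|ma] := leP a m.
    case: mA => [A0|mA]; last first.
      exists m; split; first by right; rewrite inE mA orbT.
      by move=> b; rewrite inE => /predU1P[->//|/mP].
    by exists a; rewrite A0; split=> [|b]; rewrite ?inE ?eqxx; [right|move/eqP->].
  exists a; split; first by right; rewrite inE eqxx.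
  by move=> b; rewrite inE => /predU1P[->//|/mP bm]; rewrite (le_trans bm) ?ltW.
move=> AB; have [m [mA mP]] := lub A.
have [m' [mB mP']] := lub [seq - b | b <- B].
have le_m' b : b \in B -> - m' <= b.
  by move=> bB; rewrite lerNl mP' // map_f.
case: mA => [A0|mA].
  exists (- m' - 1); rewrite A0; split=> // b /le_m'; lra.
case: mB => [B0|mB].
  exists (m + 1); split=> [a /mP|b]; first by lra.
  by case: B B0 {AB mP' le_m'}.
have [b bB mb] := mapP mB.
have := AB _ _ mA bB; rewrite -(opprK b) -mb => mm'.
exists ((m - m') / 2); split=> [a /mP|b' /le_m']; lra.
Qed.

(** Gordan's alternative, by induction on the number of generators. A functional [xi] positive on
    all generators but [w] is corrected by a functional [eta] that is positive where the segments
    from [w] to the others meet the kernel of [xi]. *)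
Lemma gordan W : ~ hull W 0 -> exists xi, forall w, w \in W -> 0 < dot xi w.
Proof.
have [n] := ubnP (size W); elim: n W => // n IH [|w W] /=; first by exists 0.
rewrite ltnS => sW W0.
(* A single generator is its own witness; afterwards [w1] shows that [W] is nonempty, which the case
   [dot xi w = 0] uses. *)
case: W sW W0 => [|w1 W1] sW W0.
  exists w => v; rewrite inE => /eqP->; apply: dot_sqr_gt0.
  apply/eqP => w0; apply: W0; rewrite -w0; apply: hull_mem.
  by rewrite w0 mem_seq1.
set W := w1 :: W1 in sW W0.
have [|xi xiP] := IH W sW.
  by move=> h; apply: W0; apply: hull_sub h => v vW; apply: hull_mem; rewrite inE vW orbT.
have [wgt|wle] := ltP 0 (dot xi w).
  by exists xi => v; rewrite inE => /predU1P[->|/xiP].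
(* [g v] is the point between [w] and [v] at which [xi] vanishes. *)
pose t v := - dot xi w / (dot xi v - dot xi w).
pose g v := t v *: v + (1 - t v) *: w.
have t01 v : v \in W -> 0 <= t v <= 1.
  move=> /xiP vgt; rewrite divr_ge0 ?ler_pdivrMr; lra.
have [||eta etaP] := IH [seq g v | v <- W].
- by rewrite size_map.
- move=> h; apply: W0; apply: hull_sub h => _ /mapP[v vW ->].
  have /andP[t0 t1] := t01 _ vW.
  by apply: hull_conv => //; apply: hull_mem; rewrite inE ?vW ?eqxx ?orbT.
have key v : v \in W -> 0 < - dot xi w * dot eta v + dot xi v * dot eta w.
  move=> vW; have := etaP _ (map_f g vW); rewrite !dotE.
  have vgt := xiP _ vW.
  have pos : 0 < dot xi v - dot xi w by lra.
  rewrite -(pmulr_lgt0 _ pos) /t mulrDl => h; move: h; congr (_ < _).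
  by field; rewrite gt_eqF.
(* The lower bounds on [c] make [eta + c *: xi] positive on [W], the upper bound makes it positive
   at [w]; if [dot xi w = 0], the value at [w] does not depend on [c]. *)
have [|c [cA cB]] := @between [seq - dot eta v / dot xi v | v <- W]
  (if dot xi w == 0 then [::] else [:: dot eta w / - dot xi w]).
- move=> _ b /mapP[v vW ->]; case: ifP => // /negbT w0.
  rewrite inE => /eqP->.
  have w0' : 0 < - dot xi w by rewrite oppr_gt0 lt_neqAle w0.
  rewrite ltr_pdivrMr ?xiP // mulrAC ltr_pdivlMr //.
  by have := key _ vW; lra.
exists (eta + c *: xi) => v; rewrite inE !dotE => /predU1P[->|vW]; last first.
  have := cA _ (map_f _ vW); rewrite ltr_pdivrMr ?xiP //; lra.
case: eqP cB => [w0 _|/eqP w0 cB]; last first.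
  have w0' : 0 < - dot xi w by rewrite oppr_gt0 lt_neqAle w0.
  by have := cB _ (mem_head _ _); rewrite ltr_pdivlMr //; lra.
have w1W : w1 \in W by rewrite inE eqxx.
have := key _ w1W; rewrite w0 oppr0 mul0r add0r mulr0 addr0.
by rewrite pmulr_rgt0 // xiP.
Qed.

Lemma separation W x : ~ hull W x ->
  exists xi, forall w, w \in W -> dot xi w < dot xi x.
Proof.
move=> Wx; have [|xi xiP] := @gordan [seq w - x | w <- W].
  by move/hull_translateE; rewrite sub0r opprK.
exists (- xi) => w /(map_f (fun w => w - x)) /xiP; rewrite !dotE; lra.
Qed.

(** The new generators are the old ones in the half-space and the crossing points of segments that
    join generators strictly on opposite sides. A point missed by them would be separated by some
    [z], and tilting [z] along [xi] would separate it from [V] as well. *)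
Lemma hull_halfspace V xi s :
  exists V', forall x, hull V' x <-> hull V x /\ s <= dot xi x.
Proof.
pose t a b := (s - dot xi b) / (dot xi a - dot xi b).
pose g a b := t a b *: a + (1 - t a b) *: b.
pose U := [seq v <- V | s < dot xi v]; pose L := [seq v <- V | dot xi v < s].
pose V' := [seq v <- V | s <= dot xi v] ++ [seq g a b | a <- U, b <- L].
have gP a b : s < dot xi a -> dot xi b < s ->
    [/\ 0 <= t a b, t a b <= 1 & dot xi (g a b) = s].
  move=> sa bs; have pos : 0 < dot xi a - dot xi b by lra.
  split; rewrite ?divr_ge0 ?ler_pdivrMr; try lra.
  by rewrite /g !dotE /t; field; rewrite gt_eqF.
have V'P v : v \in V' -> hull V v /\ s <= dot xi v.
  rewrite mem_cat mem_filter => /orP[/andP[sv vV]|]; first by split=> //; apply: hull_mem.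
  case/allpairsP => -[a b] /= [].
  rewrite !mem_filter => /andP[sa aV] /andP[bs bV] ->.
  have [t0 t1 gs] := gP _ _ sa bs; split; last by rewrite gs.
  by apply: hull_conv => //; apply: hull_mem.
exists V' => x; split.
  move=> h; split; first by apply: hull_sub h => v /V'P[].
  rewrite -lerN2 -dotNl; apply: hull_le h => v /V'P[_].
  by rewrite dotNl; lra.
case=> Vx sx; apply: contrapT => /separation[z zP].
have zU a : a \in V -> s <= dot xi a -> dot z a < dot z x.
  by move=> aV sa; apply: zP; rewrite mem_cat mem_filter sa aV.
(* The bounds say that [z + c *: xi] stays below [dot z x + c * s] at the generators on either side
   of the cut; the entry 0 forces [c] to be positive. *)
have [|c [cA cB]] := @between
    (0 :: [seq (dot z b - dot z x) / (s - dot xi b) | b <- L])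
    [seq (dot z x - dot z a) / (dot xi a - s) | a <- U].
- move=> l _ lA /mapP[a + ->]; rewrite mem_filter => /andP[sa aV].
  have za := zU _ aV (ltW sa).
  move: lA; rewrite inE => /predU1P[->|]; first by rewrite divr_gt0; lra.
  case/mapP => b + ->; rewrite mem_filter => /andP[bs bV].
  have [_ _ _] := gP _ _ sa bs.
  have : dot z (g a b) < dot z x.
    apply: zP; rewrite mem_cat; apply/orP; right.
    by apply: allpairs_f; rewrite mem_filter ?sa ?bs.
  rewrite /g !dotE => h.
  have sb : 0 < s - dot xi b by lra.
  have sa' : 0 < dot xi a - s by lra.
  have pos : 0 < dot xi a - dot xi b by lra.
  rewrite ltr_pdivrMr // mulrAC ltr_pdivlMr //.
  move: h; rewrite -subr_gt0 -(pmulr_lgt0 _ pos).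
  set e := (X in 0 < X).
  have -> : e = dot z x * (dot xi a - dot xi b) - (s - dot xi b) * dot z a
                - (dot xi a - s) * dot z b.
    by rewrite /e /t; field; rewrite gt_eqF.
  lra.
have c0 : 0 < c by apply: cA; rewrite inE eqxx.
(* This contradicts [s <= dot xi x], as [c] is positive. *)
have : dot (z + c *: xi) x < dot z x + c * s; last by rewrite !dotE; nra.
apply: hull_lt Vx => v vV; rewrite !dotE.
case: (ltgtP (dot xi v) s) => [vs|sv|vs]; last by rewrite vs ltrD2r zU ?vs.
- have /cA : (dot z v - dot z x) / (s - dot xi v) \in
      0 :: [seq (dot z b - dot z x) / (s - dot xi b) | b <- L].
    by rewrite inE; apply/orP; right; apply/mapP; exists v; rewrite ?mem_filter ?vs.
  rewrite ltr_pdivrMr; lra.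
- have /cB : (dot z x - dot z v) / (dot xi v - s) \in
      [seq (dot z x - dot z a) / (dot xi a - s) | a <- U].
    by apply/mapP; exists v; rewrite ?mem_filter ?sv.
  rewrite ltr_pdivlMr; lra.
Qed.

End Hull.

(** * Euler characteristic *)

Section Euler.
Variables (F : realFieldType) (d : nat).
Implicit Types (x y z xi : 'rV[F]_d) (V W : seq 'rV[F]_d).

Lemma hull_halfspaces V (C : seq ('rV[F]_d * F)) :
  exists V', forall x, hull V' x <->
    hull V x /\ forall c, c \in C -> c.2 <= dot c.1 x.
Proof.
elim: C => [|[xi s] C [V' V'P]]; first by exists V => x; split=> [|[]//].
have [V'' V''P] := hull_halfspace V' xi s; exists V'' => x; rewrite V''P V'P.
split=> [[[Vx Cx] sx]|[Vx Cx]].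
  by split=> // c; rewrite inE => /predU1P[->//|/Cx].
split; last by apply: (Cx (xi, s)); rewrite inE eqxx.
by split=> // c cC; apply: Cx; rewrite inE cC orbT.
Qed.

Lemma hull_slice V xi s :
  exists V', forall x, hull V' x <-> hull V x /\ dot xi x = s.
Proof.
have [V' V'P] := hull_halfspaces V [:: (xi, s); (- xi, - s)].
exists V' => x; rewrite V'P; split=> -[Vx Cx]; split=> //.
  have := Cx (xi, s); have := Cx (- xi, - s).
  rewrite !inE !eqxx orbT => /(_ isT) /= + /(_ isT) /=; rewrite dotNl; lra.
move=> c; rewrite !inE => /orP[] /eqP-> /=; rewrite ?dotNl Cx; lra.
Qed.

Lemma seq_argmax (T : eqType) (f : T -> F) (s : seq T) : s != [::] ->
  exists2 m, m \in s & forall t, t \in s -> f t <= f m.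
Proof.
elim: s => // a [_ _|b s /(_ isT)[m ms mP] _].
  by exists a => [|x]; rewrite inE ?eqxx // => /eqP->.
have [am|/ltW ma] := leP (f a) (f m).
  exists m => [|x]; rewrite inE ?ms ?orbT //.
  by case/predU1P => [->//|/mP].
exists a => [|x]; rewrite inE ?eqxx //.
by case/predU1P => [->//|/mP/le_trans->].
Qed.

Lemma hull_nonempty V : (V != [::]) <-> exists x, hull V x.
Proof.
case: V => [|v V]; split=> //; first by case=> x /hull_nil.
by move=> _; exists v; apply: hull_mem; rewrite inE eqxx.
Qed.

Lemma hull_range V xi : V != [::] -> exists a b, a <= b /\
  forall t, (exists x, hull V x /\ dot xi x = t) <-> a <= t <= b.
Proof.
move=> V0; have [v vV vP] := seq_argmax (dot xi) V0.
have [w wV wP] := seq_argmax (fun x => - dot xi x) V0.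
exists (dot xi w), (dot xi v); split=> [|t]; first by rewrite vP.
split=> [[x [Vx <-]]|/andP[wt tv]].
  rewrite (hull_le vP Vx) andbT -lerN2 -dotNl; apply: hull_le Vx => u uV.
  by rewrite dotNl wP.
have [wv|vw] := ltP (dot xi w) (dot xi v); last first.
  by exists v; split; [exact: hull_mem | lra].
pose l := (t - dot xi w) / (dot xi v - dot xi w).
exists (l *: v + (1 - l) *: w); split; last first.
  by rewrite !dotE /l; field; rewrite subr_eq0 gt_eqF.
by apply: hull_conv; rewrite ?divr_ge0 ?ler_pdivrMr; try lra; apply: hull_mem.
Qed.

(** Passing from [s] to a point just to its right loses exactly the intervals that end at [s], so
    their coefficients sum to 0. Every interval ends somewhere. *)
Lemma interval_sum0 (I : finType) (c : I -> int) (a b : I -> F) :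
  (forall i, a i <= b i) -> (forall s, \sum_(i | a i <= s <= b i) c i = 0) ->
  \sum_i c i = 0.
Proof.
move=> ab c0.
have cb s : \sum_(i | b i == s) c i = 0.
  (* [t] lies to the right of [s] and before the next endpoint of any interval. *)
  have [|t [st tP]] := @between F [:: s]
      [seq x <- [seq a i | i : I] ++ [seq b i | i : I] | s < x].
    by move=> u v; rewrite inE mem_filter => /eqP-> /andP[].
  have {}st : s < t by apply: st; rewrite inE.
  have ta i : (a i <= t) = (a i <= s).
    have [sa|//] := ltP s (a i); last by move/le_trans->; rewrite ?ltW.
    apply/negbTE; rewrite -ltNge tP // mem_filter sa mem_cat.
    by rewrite fintype.image_f.
  have tb i : (t <= b i) = (s < b i).
    have [sb|bs] := ltP s (b i); last by apply/negbTE; rewrite -ltNge (le_lt_trans bs).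
    by rewrite ltW // tP // mem_filter sb mem_cat fintype.image_f ?orbT.
  have := c0 s; rewrite (bigID (fun i => b i == s)) /= [X in _ + X](_ : _ = 0).
    rewrite addr0 => h; rewrite -[RHS]h; apply: eq_bigl => i; have := ab i.
    by case: eqP => [->->|]; rewrite ?lexx // andbF.
  rewrite -[RHS](c0 t); apply: eq_bigl => i; rewrite ta tb -andbA; congr (_ && _).
  by rewrite lt_neqAle eq_sym andbC.
have -> : \sum_i c i = \sum_(s <- undup [seq b i | i : I]) \sum_(i | b i == s) c i.
  rewrite (exchange_big_dep predT) //=; apply: eq_bigr => i _.
  rewrite -big_filter (_ : filter _ _ = [:: b i]) ?big_seq1 //.
  have := filter_pred1_uniq (undup_uniq [seq b i | i : I]) (_ : b i \in _).
  move=> <-; first by apply: eq_filter => s; rewrite eq_sym.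
  by rewrite mem_undup fintype.image_f.
by rewrite big1.
Qed.

(* Hadwiger's argument that the Euler characteristic is well defined: sweep a
   hyperplane along a coordinate axis; each slice is handled by induction, which
   leaves the one-dimensional statement about the ranges of that coordinate. *)
Lemma euler_sum0 (I : finType) (c : I -> int) (V : I -> seq 'rV[F]_d) (k : nat)
    (s : 'rV[F]_d) :
  (forall i v (j : 'I_d), v \in V i -> (k <= j)%N -> v 0 j = s 0 j) ->
  (forall x, \sum_(i | `[< hull (V i) x >]) c i = 0) ->
  \sum_(i | V i != [::]) c i = 0.
Proof.
elim: k V s => [|k IH] V s Vs V0.
  (* With all coordinates frozen, every generator equals [s], so a hull is nonempty exactly when it
     contains [s]. *)
  rewrite -[RHS](V0 s); apply: eq_bigl => i; apply/idP/asboolP => [|h]; last first.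
    by apply/hull_nonempty; exists s.
  case: (V i) (Vs i) => [//|v W] vs _; apply: hull_mem; rewrite inE; apply/orP.
  by left; apply/eqP/rowP => j; rewrite (vs v) // inE eqxx.
have [kd|dk] := ltnP k d; last first.
  by apply: (IH V s) => // i v j vV kj; have := ltn_ord j; rewrite ltnNge (leq_trans dk).
pose e : 'rV[F]_d := delta_mx 0 (Ordinal kd).
have /choice[S SP] (ti : F * I) :
    exists V', forall x, hull V' x <-> hull (V ti.2) x /\ dot e x = ti.1.
  exact: hull_slice.
have /choice[ab abP] i : exists ab : F * F, ab.1 <= ab.2 /\
    (V i != [::] -> forall t, S (t, i) != [::] <-> ab.1 <= t <= ab.2).
  have [Vi0|Vi0] := eqVneq (V i) [::]; first by exists (0, 0).
  have [a [b [ab abP]]] := hull_range e Vi0.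
  exists (a, b); split=> //= _ t; rewrite -abP hull_nonempty.
  by split=> -[x h]; exists x; [apply: (SP (t, i) x).1 h | apply: (SP (t, i) x).2 h].
(* Empty lists received the dummy interval from 0 to 0; giving them coefficient 0 makes it
   harmless. *)
rewrite big_mkcond /=.
apply: (@interval_sum0 _ _ (fun i => (ab i).1) (fun i => (ab i).2)).
  by move=> i; case: (abP i).
move=> t; rewrite -big_mkcondr /=.
have {}IH := IH (fun i => S (t, i)) (\row_j (if k == j then t else s 0 j)).
rewrite -[RHS]IH.
- apply: eq_bigl => i; apply/andP/idP => [[h Vi0]|h].
    by case: (abP i) => _ /(_ Vi0 t) /iffRL; apply.
  have Vi0 : V i != [::].
    by apply/hull_nonempty; have /hull_nonempty[x /(SP (t, i))[Vx _]] := h; exists x.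
  by split=> //; case: (abP i) => _ /(_ Vi0 t) /iffLR; apply.
(* Generators of a slice are new points, but they lie in [hull (V i)], where the coordinates beyond
   [k] are already constant. *)
- move=> i v j /hull_mem/(SP (t, i))[/= Vv ve] kj; rewrite mxE; case: eqP => [kj'|/eqP kj'].
    by rewrite -ve dot_delta; congr (v 0 _); apply: val_inj.
  have lt_kj : (k < j)%N by rewrite ltn_neqAle kj'.
  have le_vs : dot (delta_mx 0 j) v <= s 0 j.
    by apply: hull_le Vv => w wV; rewrite dot_delta (Vs i).
  have : dot (- delta_mx 0 j) v <= - s 0 j.
    by apply: hull_le Vv => w wV; rewrite dotNl dot_delta (Vs i).
  by move: le_vs; rewrite dotNl !dot_delta; lra.
- move=> x; have [xt|xt] := eqVneq (dot e x) t.
    rewrite -[RHS](V0 x); apply: eq_bigl => i; apply/asboolP/asboolP => [/(SP (t, i))[]//|Vx].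
    by apply/(SP (t, i)).
  rewrite big_pred0 // => i; apply/asboolP => /(SP (t, i))[_ /= /eqP].
  by rewrite (negbTE xt).
Qed.

(** Every nonempty hull has Euler characteristic 1. The two families are merged into one signed sum
    over [I + I], with no coordinate frozen at the start. *)
Lemma euler_card (I : finType) (A B : I -> seq 'rV[F]_d) :
  (forall x, #|[pred i | `[< hull (A i) x >]]| = #|[pred i | `[< hull (B i) x >]]|) ->
  #|[pred i | A i != [::]]| = #|[pred i | B i != [::]]|.
Proof.
move=> AB.
pose V (i : I + I) := match i with inl i => A i | inr i => B i end.
pose c (i : I + I) : int := if i is inl _ then 1 else -1.
have sumc (P : pred (I + I)) : \sum_(i | P i) c i =
    #|[pred i | P (inl i)]|%:Z - #|[pred i | P (inr i)]|%:Z.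
  rewrite big_sumType /=; congr (_ + _); first by rewrite sumr_const natz.
  by rewrite sumr_const mulNrn natz.
have := @euler_sum0 _ c V d 0; rewrite sumc => h.
apply/eqP; rewrite -eqz_nat -subr_eq0; apply/eqP; apply: h.
  by move=> i v j _; rewrite leqNgt ltn_ord.
by move=> x; rewrite sumc /= AB subrr.
Qed.

End Euler.

(** [fset_set] is meaningful only for finite sets; the container [Z] supplies finiteness and a
    finite index type, as required by [euler_card]. *)
Lemma card_fset_set_sub (T : choiceType) (A : set T) (Z : {fset T}) :
  (forall x, A x -> x \in Z) -> #|` fset_set A|%fset = #|[pred z : Z | `[< A (val z) >]]|.
Proof.
move=> AZ.
have finA : finite_set A.
  by apply: sub_finite_set (finite_fset Z) => x /AZ.
have -> : fset_set A = [fset val z | z : Z & `[< A (val z) >]]%fset.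
  apply/fsetP => x; rewrite in_fset_set //; apply/idP/imfsetP.
    by rewrite inE => Ax; exists [` AZ x Ax]%fset => //=; rewrite inE.
  by case=> z + ->; rewrite !inE.
rewrite card_imfset; last exact: val_inj.
rewrite /= cardE /enum_mem -filter_predI; congr size.
by apply: eq_filter => z; rewrite /= andbT.
Qed.

(** * Faces and small slices *)

Section Near0.
Variable F : realFieldType.

(** Nested uses let a later threshold depend on an earlier parameter, as [delta] on [e] in
    [near_slice]. *)
Definition near0 (P : F -> Prop) :=
  exists2 e0, 0 < e0 & forall e, 0 < e -> e <= e0 -> P e.

Lemma near0_all (I : finType) (P : I -> F -> Prop) :
  (forall i, near0 (P i)) -> near0 (fun e => forall i, P i e).
Proof.
move=> nP; suff: near0 (fun e => forall i, i \in enum I -> P i e).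
  by case=> e0 e0P h; exists e0 => // e ep le i; apply: h; rewrite ?mem_enum.
elim: (enum I) => [|i s [e1 e1p h1]]; first by exists 1.
have [e2 e2p h2] := nP i.
exists (Num.min e1 e2); first by rewrite lt_min e1p.
move=> e ep; rewrite le_min => /andP[le1 le2] j; rewrite inE => /predU1P[->|js].
  exact: h2.
exact: h1.
Qed.

Lemma near0_and (P Q : F -> Prop) :
  near0 P -> near0 Q -> near0 (fun e => P e /\ Q e).
Proof.
move=> nP nQ; have [b|e0 e0p h] := @near0_all bool (fun b => if b then P else Q).
  by case: b.
by exists e0 => // e ep le; split; [apply: (h e ep le true) | apply: (h e ep le false)].
Qed.

Lemma near0_ex (P : F -> Prop) : near0 P -> exists2 e, 0 < e & P e.
Proof. by case=> e ep /(_ e ep (lexx e)); exists e. Qed.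

Lemma near0_le c : 0 < c -> near0 (fun e => e <= c).
Proof. by exists c. Qed.

Lemma near0_mono (P Q : F -> Prop) :
  (forall e, 0 < e -> P e -> Q e) -> near0 P -> near0 Q.
Proof. by move=> PQ [e ep h]; exists e => // e' e'p le; apply/PQ/h. Qed.

End Near0.

Section Faces.
Variables (F : realFieldType) (d : nat).
Implicit Types (x y z xi : 'rV[F]_d) (V W : seq 'rV[F]_d).

(** The maximum norm makes this neighbourhood polyhedral, so cutting a hull with it yields a hull
    again. *)
Definition box (e : F) x := forall j, `|x 0 j| <= e.

Lemma dot_box zeta y e : box e y -> `|dot zeta y| <= e * \sum_j `|zeta 0 j|.
Proof.
move=> ey; rewrite mulr_sumr; apply: le_trans (ler_norm_sum _ _ _) _.
by apply: ler_sum => j _; rewrite normrM mulrC ler_wpM2r.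
Qed.

Lemma box_sum x : box (\sum_j `|x 0 j|) x.
Proof. by move=> j; rewrite (bigD1 j) //= lerDl sumr_ge0. Qed.

Lemma hull_box_slice V e xi s :
  exists V', forall x, hull V' x <-> [/\ hull V x, box e x & dot xi x = s].
Proof.
pose C := [seq (delta_mx 0 j : 'rV[F]_d, - e) | j : 'I_d] ++
          [seq (- delta_mx 0 j : 'rV[F]_d, - e) | j : 'I_d].
have [V1 V1P] := hull_halfspaces V C.
have [V2 V2P] := hull_slice V1 xi s.
exists V2 => x; rewrite V2P V1P; split=> [[[Vx Cx] sx]|[Vx ex sx]].
  split=> // j; rewrite ler_norml; apply/andP; split.
    have := Cx (delta_mx 0 j, - e); rewrite /= dot_delta; apply.
    by rewrite mem_cat; apply/orP; left; apply/mapP; exists j; rewrite ?mem_enum.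
  have := Cx (- delta_mx 0 j, - e); rewrite /= dotNl dot_delta lerN2; apply.
  by rewrite mem_cat; apply/orP; right; apply/mapP; exists j; rewrite ?mem_enum.
split=> //; split=> // c; rewrite mem_cat => /orP[] /mapP[j _ ->] /=;
  by rewrite ?dotNl dot_delta; have := ex j; rewrite ler_norml => /andP[]; lra.
Qed.

(** A face is a sublist of the generators, strictly shorter unless [xi] is constant on [V]; this
    drives the final induction. *)
Definition face V xi := [seq v <- V | all (fun u => dot xi u <= dot xi v) V].

Lemma mem_face V xi v :
  v \in face V xi <-> v \in V /\ forall u, u \in V -> dot xi u <= dot xi v.
Proof. by rewrite mem_filter; split=> [/andP[/allP]|[vV /allP->]]. Qed.

Lemma hull_face V xi x : hull (face V xi) x <->
  hull V x /\ forall u, u \in V -> dot xi u <= dot xi x.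
Proof.
split=> [h|[]].
  split; first by apply: hull_sub h => v /mem_face[vV _]; apply: hull_mem.
  move=> u uV; have : dot (- xi) x <= - dot xi u; last by rewrite dotNl; lra.
  by apply: hull_le h => v /mem_face[_ /(_ _ uV)]; rewrite dotNl; lra.
elim=> [v vV vP|t y z t0 t1 Vy IHy Vz IHz yz].
  by apply: hull_mem; apply/mem_face.
have [v vV vP] : exists2 v, v \in V & forall u, u \in V -> dot xi u <= dot xi v.
  by apply: seq_argmax; apply/hull_nonempty; exists y.
have yv := hull_le vP Vy; have zv := hull_le vP Vz; have := yz _ vV.
rewrite !dotE => h.
(* For [t] strictly between 0 and 1, a combination is maximal only if both of its points are; at the
   ends only one of them matters. *)
have [t_0|tn0] := eqVneq t 0.
  rewrite t_0 scale0r add0r subr0 scale1r; apply: IHz => u /vP; nra.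
have [t_1|tn1] := eqVneq t 1.
  rewrite t_1 subrr scale0r addr0 scale1r; apply: IHy => u /vP; nra.
have tgt0 : 0 < t by rewrite lt_neqAle eq_sym tn0.
have tlt1 : 0 < 1 - t by rewrite subr_gt0 lt_neqAle tn1.
apply: hull_conv => //.
  apply: IHy => u /vP uv; apply: le_trans uv _; rewrite leNgt; apply/negP => h1.
  have := ltr_pM2l tgt0 (dot xi y) (dot xi v); rewrite h1.
  have := ler_wpM2l (ltW tlt1) zv; lra.
apply: IHz => u /vP uv; apply: le_trans uv _; rewrite leNgt; apply/negP => h1.
have := ltr_pM2l tlt1 (dot xi z) (dot xi v); rewrite h1.
have := ler_wpM2l (ltW tgt0) yv; lra.
Qed.

(* Near p the polytope is its tangent cone, which reaches into [dot xi y > 0]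
   unless xi is maximal at p. *)
Lemma near_slice V xi p : near0 (fun e => near0 (fun delta =>
  (exists y, [/\ hull V (y + p), box e y & dot xi y = delta]) <->
  hull V p /\ ~ hull (face V xi) p)).
Proof.
have [Vp|Vp] := pselect (hull V p); last first.
  have [zeta zP] := separation Vp.
  case: (eqVneq V [::]) => [V0|V0].
    exists 1 => // e _ _; exists 1 => // delta _ _; split=> [[y []]|[]//].
    by rewrite V0 => /hull_nil.
  have [v vV vP] := seq_argmax (dot zeta) V0.
  (* The 1 keeps [M] positive. With [e * M] at most the gap between [p] and the hull, [zeta] varies
     too little over the box to bridge it. *)
  pose M := 1 + \sum_j `|zeta 0 j|.
  have Mp : 0 < M by rewrite ltr_wpDr ?sumr_ge0.
  have gp : 0 < dot zeta p - dot zeta v by rewrite subr_gt0 zP.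
  exists ((dot zeta p - dot zeta v) / M); first by rewrite divr_gt0.
  move=> e ep; rewrite ler_pdivlMr // => eM.
  exists 1 => // delta _ _; split=> [[y [Vy ey _]]|[]//].
  have := hull_le vP Vy; rewrite dotDr.
  have := dot_box zeta ey; rewrite ler_norml => /andP[h _].
  by move: eM; rewrite /M; nra.
have [fp|fp] := pselect (hull (face V xi) p).
  exists 1 => // e _ _; exists 1 => // delta dp _; split=> [[y [Vy _ yd]]|[_ []//]].
  have /hull_face[_ pP] := fp.
  by have := hull_le pP Vy; rewrite dotDr yd; lra.
have [v vV vp] : exists2 v, v \in V & dot xi p < dot xi v.
  apply: contrapT => h; apply: fp; apply/hull_face; split=> // u uV.
  by rewrite leNgt; apply/negP => pu; apply: h; exists u.
exists 1 => // e ep _.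
pose M := 1 + \sum_j `|(v - p) 0 j|.
have Mp : 0 < M by rewrite ltr_wpDr ?sumr_ge0.
have gp : 0 < dot xi v - dot xi p by rewrite subr_gt0.
apply: near0_mono (near0_and (near0_le gp)
  (near0_le (divr_gt0 (mulr_gt0 ep gp) Mp))) => delta dp [d1 d2].
(* Move from [p] towards [v] until [xi] has grown by [delta]; one bound on [delta] gives [t <= 1],
   the other keeps the step in the box. *)
split=> // _; pose t := delta / (dot xi v - dot xi p).
have t0 : 0 <= t by rewrite divr_ge0 ?ltW.
have t1 : t <= 1 by rewrite ler_pdivrMr // mul1r.
exists (t *: (v - p)); split.
- rewrite (_ : _ + p = t *: v + (1 - t) *: p).
    by apply: hull_conv => //; apply: hull_mem.
  by apply/rowP => j; rewrite !mxE; ring.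
- move=> j; rewrite mxE normrM (ger0_norm t0).
  have tM : t * M <= e by rewrite /t mulrAC ler_pdivrMr // -ler_pdivlMr.
  apply: le_trans tM; rewrite ler_wpM2l //.
  by have := box_sum (v - p) j; rewrite /M; lra.
- by rewrite dotZr dotDr dotNr /t; field; rewrite gt_eqF.
Qed.

End Faces.

(** * Lattice point counts *)

Section Lattice.
Variable d : nat.
Implicit Types (x y p xi : 'rV[rat]_d) (V W : seq 'rV[rat]_d) (z : 'rV[int]_d).

Definition zq z : 'rV[rat]_d := map_mx intr z.

Lemma zqD z1 z2 : zq (z1 + z2) = zq z1 + zq z2.
Proof. by apply/rowP => j; rewrite !mxE intrD. Qed.

Lemma zqN z : zq (- z) = - zq z.
Proof. by apply/rowP => j; rewrite !mxE intrN. Qed.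

Lemma zq0 : zq 0 = 0.
Proof. by apply/rowP => j; rewrite !mxE. Qed.

Definition lat V x : set 'rV[int]_d := [set z | hull V (zq z + x)]%classic.

(** This is N_P of the overview: the number of points of the hull in the coset of [x] modulo the
    lattice. *)
Definition latN V x := #|` fset_set (lat V x)|%fset.

Definition per_eq V W := forall x, latN V x = latN W x.

Lemma hull_bounded V : exists K : rat, forall x, hull V x -> box K x.
Proof.
have [K KP] : exists K : rat, forall v, v \in V -> box K v.
  elim: V => [|v V [K KP]]; first by exists 0.
  exists (\sum_j `|v 0 j| + `|K|) => w; rewrite inE => /predU1P[->|/KP wK] j.
    by rewrite ler_wpDr // box_sum.
  by apply: le_trans (wK j) _; rewrite ler_wpDl ?sumr_ge0 // ler_norm.
exists K => x Vx j; rewrite ler_norml; apply/andP; split.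
  have : dot (- delta_mx 0 j) x <= K; last by rewrite dotNl dot_delta; lra.
  apply: hull_le Vx => v /KP/(_ j); rewrite dotNl dot_delta ler_norml => /andP[]; lra.
have : dot (delta_mx 0 j) x <= K; last by rewrite dot_delta; lra.
by apply: hull_le Vx => v /KP/(_ j); rewrite dot_delta ler_norml => /andP[].
Qed.

Lemma box_fset (K : rat) : exists Z : {fset 'rV[int]_d},
  forall z, box K (zq z) -> z \in Z.
Proof.
pose N := Num.bound `|K|.
pose f (m : 'M['I_(N.*2.+1)]_(1, d)) : 'rV[int]_d := map_mx (fun k : 'I__ => k%:Z - N%:Z) m.
exists [fset f m | m : 'M['I_(N.*2.+1)]_(1, d)]%fset => z zK; apply/imfsetP.
have zN j : `|z 0 j| < N%:Z.
  have := zK j; rewrite mxE -intr_norm => zK'.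
  rewrite -(ltr_int rat) (le_lt_trans zK') // (le_lt_trans (ler_norm K)) //.
  exact: archi_boundP.
exists (map_mx (fun k : int => inord (absz (k + N%:Z))) z); rewrite ?inE //.
apply/rowP => j; rewrite !mxE inordK; have := zN j; rewrite ltr_norml => /andP[];
  move: (z 0 j) (N) => k n; lia.
Qed.

(** One finite set serves all perturbations [y] in the box, so that the counts at every [x + y] run
    over the same index type. *)
Lemma lat_fset V x e : exists Z : {fset 'rV[int]_d},
  forall y, box e y -> forall z, lat V (x + y) z -> z \in Z.
Proof.
have [K KP] := hull_bounded V.
have [Z ZP] := box_fset (K + \sum_j `|x 0 j| + e).
exists Z => y ye z /KP zK; apply: ZP => j.
have := zK j; have := ye j; have := box_sum x j; rewrite !mxE !ler_norml.
by move=> /andP[? ?] /andP[? ?] /andP[? ?]; apply/andP; split; lra.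
Qed.

(** Equal counts at [x + y] say that the small slices around the points [p z] cover each [y] equally
    often for [V] and [W]. By [euler_card] equally many slices are nonempty, and by [near_slice]
    these count the points off the face; subtracting them from the counts at [x] leaves the
    faces. *)
Lemma per_eq_face V W xi : per_eq V W -> per_eq (face V xi) (face W xi).
Proof.
move=> VW x.
have [ZV ZVP] := lat_fset V x 1; have [ZW ZWP] := lat_fset W x 1.
pose Z := (ZV `|` ZW)%fset.
have cardV y : box 1 y ->
    latN V (x + y) = #|[pred z : Z | `[< hull V (zq (val z) + (x + y)) >]]|.
  move=> y1; rewrite /latN (@card_fset_set_sub _ _ Z) // => z /ZVP h.
  by rewrite inE h.
have cardW y : box 1 y ->
    latN W (x + y) = #|[pred z : Z | `[< hull W (zq (val z) + (x + y)) >]]|.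
  move=> y1; rewrite /latN (@card_fset_set_sub _ _ Z) // => z /ZWP h.
  by rewrite inE h // orbT.
have box0 : box 1 (0 : 'rV[rat]_d) by move=> j; rewrite mxE normr0.
pose p (z : Z) := zq (val z) + x.
(* Since [Z] is finite, a single [e] and then a single [delta] work for all [z]; [e <= 1] keeps the
   slices within the range where [Z] is valid. *)
have [e ep [e1 eP]] := near0_ex
  (near0_and (near0_le ltr01) (near0_all (fun z : Z =>
     near0_and (near_slice V xi (p z)) (near_slice W xi (p z))))).
have [delta dp dP] := near0_ex
  (near0_all (fun z : Z => near0_and (eP z).1 (eP z).2)).
have slice U : exists A : Z -> seq 'rV[rat]_d, forall (z : Z) y,
    hull (A z) y <-> [/\ hull U (y + p z), box e y & dot xi y = delta].
  have /choice[A AP] (z : Z) : exists A, forall y,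
      hull A y <-> [/\ hull U (y + p z), box e y & dot xi y = delta].
    have [A AP] := hull_box_slice [seq u - p z | u <- U] e xi delta.
    by exists A => y; rewrite AP (propext (hull_translateE _ _ _)) opprK.
  by exists A.
have [A AP] := slice V; have [B BP] := slice W.
have AB y : #|[pred z : Z | `[< hull (A z) y >]]| = #|[pred z : Z | `[< hull (B z) y >]]|.
  have [[ye yd]|ny] := pselect (box e y /\ dot xi y = delta); last first.
    rewrite !eq_card0 // => z; rewrite inE; apply/asboolP.
      by move/BP => [_ ? ?]; apply: ny.
    by move/AP => [_ ? ?]; apply: ny.
  have y1 : box 1 y by move=> j; apply: le_trans (ye j) _.
  transitivity (latN V (x + y)).
    rewrite cardV //; apply: eq_card => z; apply: asbool_equiv_eq.
    by rewrite AP /p (addrC y) -addrA; split=> [[]|].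
  rewrite VW cardW //; apply: eq_card => z; apply: asbool_equiv_eq.
  by rewrite BP /p (addrC y) -addrA; split=> [|[]].
have count U (C : Z -> seq 'rV[rat]_d) :
    (forall y, box 1 y ->
       latN U (x + y) = #|[pred z : Z | `[< hull U (zq (val z) + (x + y)) >]]|) ->
    (forall z, lat U x z -> z \in Z) ->
    (forall z : Z, C z != [::] <-> hull U (p z) /\ ~ hull (face U xi) (p z)) ->
    latN U x = (latN (face U xi) x + #|[pred z : Z | C z != [::]]|)%N.
  move=> cardU UZ CP; rewrite -[in LHS](addr0 x) cardU // addr0.
  rewrite {1}/latN (@card_fset_set_sub _ _ Z); last first.
    by move=> z /hull_face[Uz _]; apply: UZ.
  rewrite -(cardID [pred z : Z | `[< hull (face U xi) (p z) >]]).
  congr (_ + _)%N; apply: eq_card => z; rewrite !inE.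
    rewrite /lat /= -/(p z); apply/andP/asboolP => [[_ /asboolP]//|h].
    by split; apply/asboolP => //; have /hull_face[] := h.
  apply/andP/idP => [[/asboolP ? /asboolP ?]|/CP[? ?]]; first exact/CP.
  by split; apply/asboolP.
have cV := count V A cardV; have cW := count W B cardW.
have := VW x; rewrite cV ?cW.
- by rewrite (euler_card AB) => /addIn.
- by move=> z zx; rewrite inE (ZWP 0) ?orbT ?addr0.
- move=> z; rewrite -(dP z).2 hull_nonempty.
  by split=> -[y yP]; exists y; apply/BP.
- by move=> z zx; rewrite inE (ZVP 0) ?addr0.
- move=> z; rewrite -(dP z).1 hull_nonempty.
  by split=> -[y yP]; exists y; apply/AP.
Qed.

End Lattice.

(** * Comparison of support functions *)

Section Path.
Variable F : realFieldType.

Definition affine_on (D : F -> F) a b :=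
  exists p q, forall s, a <= s -> s <= b -> D s = p + q * s.

Lemma affine_on_eq0 D a b c e : affine_on D a b -> a <= c -> c < e -> e <= b ->
  D c = 0 -> D e = 0 -> forall s, a <= s -> s <= b -> D s = 0.
Proof.
move=> [p [q Dpq]] ac ce eb Dc De s as_ sb.
have := Dpq c ac (le_trans (ltW ce) eb); have := Dpq e (le_trans ac (ltW ce)) eb.
rewrite Dc De => Ee Ec; have /eqP : q * (e - c) = 0 by lra.
rewrite mulf_eq0 subr_eq0 (gt_eqF ce) orbF => /eqP q0.
by rewrite Dpq // q0; move: Ec; rewrite q0; lra.
Qed.

(* L lists the possible breakpoints; they are removed one by one. *)
Lemma piecewise_eq0 (D : F -> F) (L : seq F) a b : a < b ->
  (forall a' b', a <= a' -> a' < b' -> b' <= b ->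
     (forall c, c \in L -> ~~ (a' < c < b')) -> affine_on D a' b') ->
  (forall s, a < s -> s < b -> near0 (fun e => affine_on D (s - e) (s + e))) ->
  near0 (fun e => forall s, a <= s -> s <= a + e -> D s = 0) ->
  forall s, a <= s -> s <= b -> D s = 0.
Proof.
elim: L a b => [|c L IH] a b ab Dpw Dloc Dstart.
  have ba : 0 < b - a by lra.
  have [e ep [eb e0]] := near0_ex (near0_and (near0_le ba) Dstart).
  have abD : affine_on D a b by apply: Dpw.
  by apply: (affine_on_eq0 (c := a) (e := a + e) abD); rewrite ?e0 //; lra.
have [/andP[ac cb]|cab] := boolP (a < c < b); last first.
  apply: IH => // a' b' aa' a'b' b'b L0; apply: Dpw => // c'.
  rewrite inE => /predU1P[->|/L0//]; apply: contra cab => /andP[h1 h2].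
  by rewrite (le_lt_trans aa') // (lt_le_trans h2).
have Dac s : a <= s -> s <= c -> D s = 0.
  apply: IH => //.
  - move=> a' b' aa' a'b' b'c L0; apply: Dpw => //; first by rewrite (le_trans b'c) ?ltW.
    move=> c'; rewrite inE => /predU1P[->|/L0//].
    by rewrite negb_and -!leNgt b'c orbT.
  - by move=> s' as' s'c; apply: Dloc => //; apply: lt_trans cb.
have Dcb s : c <= s -> s <= b -> D s = 0.
  apply: IH => //.
  - move=> a' b' ca' a'b' b'b L0; apply: Dpw => //; first by rewrite (le_trans (ltW ac)).
    move=> c'; rewrite inE => /predU1P[->|/L0//].
    by rewrite negb_and -!leNgt ca'.
  - by move=> s' cs' s'b; apply: Dloc => //; apply: lt_trans cs'.
  (* Affinity around the breakpoint [c] carries the vanishing from its left side to its right side,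
     which starts the second half. *)
  - have ca : 0 < c - a by lra.
    apply: near0_mono (near0_and (near0_le ca) (Dloc _ ac cb)).
    move=> e ep [ea De] t ct te.
    by apply: (affine_on_eq0 (c := c - e) (e := c) De); rewrite ?Dac //; lra.
by move=> s as_ sb; have [sc|/ltW cs] := leP s c; [apply: Dac | apply: Dcb].
Qed.

End Path.

(** * Support functions and their breakpoints *)

Section Support.
Variables (F : realFieldType) (d : nat).
Implicit Types (x y z u xi eta zeta : 'rV[F]_d) (V W : seq 'rV[F]_d).

Definition is_sup V xi c :=
  (exists2 v, v \in V & dot xi v = c) /\ forall v, v \in V -> dot xi v <= c.

(** The support function of the hull; the default 0 is taken only when [V] is empty. *)
Definition sup V xi : F := xget 0 [set c | is_sup V xi c]%classic.

Lemma supP V xi : V != [::] -> is_sup V xi (sup V xi).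
Proof.
move=> V0; apply: (xgetPex 0 (P := [set c | is_sup V xi c]%classic)).
by have [v vV vP] := seq_argmax (dot xi) V0; exists (dot xi v); split=> //; exists v.
Qed.

Lemma sup_ge V xi v : v \in V -> dot xi v <= sup V xi.
Proof.
by move=> vV; have [|_] := @supP V xi; [case: V vV | apply].
Qed.

Lemma is_sup_uniq V xi c c' : is_sup V xi c -> is_sup V xi c' -> c = c'.
Proof.
move=> [[v vV <-] cP] [[v' v'V <-] c'P]; apply/eqP.
by rewrite eq_le cP // c'P.
Qed.

Lemma supE V xi c : V != [::] -> is_sup V xi c -> sup V xi = c.
Proof. by move=> V0; apply: is_sup_uniq; apply: supP. Qed.

(** Translation is expressed on points because generator lists may contain redundant entries. *)
Definition hull_shift V W u := forall x, hull V (x + u) <-> hull W x.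

Lemma sup_hull_shift V W u xi : V != [::] -> W != [::] ->
  hull_shift V W u -> sup V xi = sup W xi + dot xi u.
Proof.
move=> V0 W0 VW.
have [[v vV <-] vP] := supP xi V0; have [[w wW <-] wP] := supP xi W0.
apply/eqP; rewrite eq_le; apply/andP; split.
  have : hull W (v - u) by apply/VW; rewrite subrK; apply: hull_mem.
  by move/(hull_le wP); rewrite !dotE; lra.
have /VW : hull W w by apply: hull_mem.
by move/(hull_le vP); rewrite !dotE.
Qed.

Lemma hull_shift_face V W u xi :
  hull_shift (face V xi) (face W xi) u ->
  hull_shift (face V xi) (face [seq w + u | w <- W] xi) 0.
Proof.
move=> VW x; rewrite addr0.
have -> : x = x - u + u by rewrite subrK.
rewrite VW !hull_face (propext (hull_translateE _ _ _)) addrK.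
split=> -[Wx xP]; split=> // w.
  by case/mapP => w' /xP h ->; rewrite (dotDr xi w') (dotDr xi (x - u)) lerD2r.
by move/(map_f (fun w => w + u))/xP; rewrite (dotDr xi w) (dotDr xi (x - u)) lerD2r.
Qed.

Lemma face_neq0 V xi : V != [::] -> face V xi != [::].
Proof.
move=> V0; have [v vV vP] := seq_argmax (dot xi) V0.
have : v \in face V xi by apply/mem_face.
by case: (face V xi).
Qed.

(** Generators off the face lose to it at [xi] by a positive gap, which a small change of direction
    cannot close. *)
Lemma sup_face_near V xi eta : V != [::] ->
  near0 (fun e => forall s, `|s| <= e ->
    sup V (xi + s *: eta) = sup (face V xi) (xi + s *: eta)).
Proof.
move=> V0; have fV0 := face_neq0 xi V0.
have [f fV] : exists f, f \in face V xi.
  by case: (face V xi) fV0 => // f *; exists f; rewrite inE eqxx.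
have /mem_face[fV' fP] := fV.
have {}near : near0 (fun e => forall (i : 'I_(size V)) s, `|s| <= e ->
    dot (xi + s *: eta) V`_i <= sup (face V xi) (xi + s *: eta)).
  apply: near0_all => i; have iV : V`_i \in V by rewrite mem_nth.
  have [h|] := eqVneq (dot xi V`_i) (dot xi f).
    exists 1 => // e _ _ s _; apply: sup_ge; apply/mem_face; split=> // u /fP.
    by rewrite h.
  move=> h; have gp : 0 < dot xi f - dot xi V`_i.
    by rewrite subr_gt0 lt_neqAle h fP.
  pose M := 1 + `|dot eta V`_i - dot eta f|.
  have Mp : 0 < M by rewrite ltr_pwDl.
  exists ((dot xi f - dot xi V`_i) / M); first by rewrite divr_gt0.
  move=> e ep; rewrite ler_pdivlMr // => eM s se.
  apply: le_trans (sup_ge _ fV); rewrite !dotE.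
  have : s * (dot eta V`_i - dot eta f) <= e * M; last by lra.
  apply: le_trans (ler_norm _) _; rewrite normrM ler_pM // /M; lra.
apply: near0_mono near => e ep eP s se; apply: supE => //; split.
  have [[v /mem_face[vV _] vs] _] := supP (xi + s *: eta) fV0.
  by exists v.
move=> v vV; rewrite -(nth_index 0 vV).
by move: vV; rewrite -index_mem => vV; have := eP (Ordinal vV) s se.
Qed.

(** Breakpoints occur only where two generators take the same value, so the maximizer at the
    midpoint [m] stays maximal on an interval without such crossings. *)
Lemma sup_affine V xi eta : exists L : seq F, forall a b, a < b ->
  (forall c, c \in L -> ~~ (a < c < b)) ->
  affine_on (fun s => sup V (xi + s *: eta)) a b.
Proof.
have [->|V0] := eqVneq V [::].
  exists [::] => a b _ _; exists (sup [::] 0), 0 => s _ _; rewrite mul0r addr0.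
  congr xget; apply/funext => c; apply/propext.
  by split=> -[[]].
(* Pairs with equal slopes contribute a division by zero, that is 0, a harmless extra breakpoint. *)
exists [seq (dot xi v' - dot xi v) / (dot eta v - dot eta v') | v <- V, v' <- V].
move=> a b ab L0; pose m := (a + b) / 2.
have [v vV vP] := seq_argmax (dot (xi + m *: eta)) V0.
exists (dot xi v), (dot eta v) => s as_ sb; apply: supE => //; split.
  by exists v; rewrite // !dotE mulrC.
move=> v' v'V; have := vP _ v'V; rewrite !dotE => h.
have h' := L0 _ (allpairs_f (fun v v' =>
  (dot xi v' - dot xi v) / (dot eta v - dot eta v')) vV v'V).
have am : a < m by rewrite /m; lra.
have mb : m < b by rewrite /m; lra.
have [q0|q0|q0] := ltgtP (dot eta v') (dot eta v).
- have qp : 0 < dot eta v - dot eta v' by lra.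
  have sa : (dot xi v' - dot xi v) / (dot eta v - dot eta v') <= a.
    rewrite leNgt; apply: contra h' => ->.
    by rewrite (le_lt_trans _ mb) // ler_pdivrMr //; lra.
  move: sa; rewrite ler_pdivrMr // => sa.
  have := ler_wpM2r (ltW qp) as_; lra.
- have qp : 0 < dot eta v' - dot eta v by lra.
  move: h'; rewrite -mulrNN -invrN !opprB => h'.
  have sb' : b <= (dot xi v - dot xi v') / (dot eta v' - dot eta v).
    rewrite leNgt; apply: contra h' => ->; rewrite andbT.
    by rewrite (lt_le_trans am) // ler_pdivlMr //; lra.
  move: sb'; rewrite ler_pdivlMr // => sb'.
  have := ler_wpM2r (ltW qp) sb; lra.
- by move: h; rewrite q0; lra.
Qed.

Definition constant_on V xi := forall v v', v \in V -> v' \in V -> dot xi v = dot xi v'.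

Lemma sup_constant V k xi v : v \in V -> constant_on V k ->
  sup V (xi + k) = sup V xi + dot k v.
Proof.
move=> vV kV; have V0 : V != [::] by case: V vV {kV}.
apply: supE => //; have [[w wV <-] wP] := supP xi V0; split.
  by exists w; rewrite // dotDl (kV _ _ vV wV).
by move=> w' w'V; rewrite dotDl (kV _ _ vV w'V) lerD2r wP.
Qed.

Lemma sup_scale V xi r : V != [::] -> 0 <= r -> sup V (r *: xi) = r * sup V xi.
Proof.
move=> V0 r0; apply: supE => //; have [[w wV <-] wP] := supP xi V0; split.
  by exists w; rewrite // dotZl.
by move=> w' w'V; rewrite dotZl ler_wpM2l // wP.
Qed.

(** * The sign of the difference of two support functions *)

Section Comparison.
Variables (V W : seq 'rV[F]_d) (xi0 : 'rV[F]_d).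
Hypotheses (V0 : V != [::]) (W0 : W != [::]).
Hypothesis faces : forall xi, ~ (constant_on V xi /\ constant_on W xi) ->
  exists u, hull_shift (face V xi) (face W xi) u.
Hypothesis face0 : hull_shift (face V xi0) (face W xi0) 0.

Let D xi := sup V xi - sup W xi.

(** Near [xi] both support functions are those of the faces, which differ by the translation [u];
    hence [D] is linear there. *)
Let D_near xi eta u : hull_shift (face V xi) (face W xi) u ->
  near0 (fun e => forall s, `|s| <= e -> D (xi + s *: eta) = dot (xi + s *: eta) u).
Proof.
move=> fu; apply: near0_mono (near0_and (sup_face_near xi eta V0) (sup_face_near xi eta W0)).
move=> e ep [eV eW] s se; rewrite /D eV // eW // (sup_hull_shift _ _ _ fu) ?face_neq0 //.
by rewrite addrC addKr.
Qed.

Let D_near0 eta : near0 (fun e => forall s, `|s| <= e -> D (xi0 + s *: eta) = 0).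
Proof.
by apply: near0_mono (D_near eta face0) => e ep h s /h->; rewrite dot0r.
Qed.

(** If no interior direction were constant on both lists, [D] would be locally affine inside the
    segment and zero near [xi0], hence zero at [xi]. *)
Let D_segment xi : D xi != 0 -> exists2 s, 0 < s < 1 &
  constant_on V (xi0 + s *: (xi - xi0)) /\ constant_on W (xi0 + s *: (xi - xi0)).
Proof.
move=> Dxi; apply: contrapT => nc; move/eqP: Dxi; apply.
pose g s := D (xi0 + s *: (xi - xi0)).
have <- : g 1 = D xi by rewrite /g scale1r addrCA subrr addr0.
have [LV LVP] := sup_affine V xi0 (xi - xi0).
have [LW LWP] := sup_affine W xi0 (xi - xi0).
apply: (@piecewise_eq0 _ g (LV ++ LW) 0 1) => //.
- move=> a b _ ab _ L0.
  have [|p [q pq]] := LVP a b ab.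
    by move=> c cL; apply: L0; rewrite mem_cat cL.
  have [|p' [q' pq']] := LWP a b ab.
    by move=> c cL; apply: L0; rewrite mem_cat cL orbT.
  by exists (p - p'), (q - q') => s as_ sb; rewrite /g /D pq // pq' //; ring.
- move=> s s0 s1; have [|u fu] := @faces (xi0 + s *: (xi - xi0)).
    by move=> h; apply: nc; exists s; rewrite ?s0.
  apply: near0_mono (D_near (xi - xi0) fu) => e ep eP.
  exists (dot xi0 u), (dot (xi - xi0) u) => t st ts; rewrite /g.
  have -> : xi0 + t *: (xi - xi0) = xi0 + s *: (xi - xi0) + (t - s) *: (xi - xi0).
    by rewrite -addrA -scalerDl (addrC s) subrK.
  by rewrite eP ?ler_norml; [rewrite !dotE; ring | lra].
- apply: near0_mono (D_near0 (xi - xi0)) => e ep eP s s0 se.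
  by rewrite /g eP // ger0_norm //; lra.
Qed.

(* The constant functional k met on the segment from xi0 to xi satisfies
   D (zeta + r k) = D zeta, and xi is a positive combination of k and - xi0. *)
Let D_opposite xi : D xi != 0 -> exists2 r, 0 < r & D xi = r * D (- xi0).
Proof.
move=> /D_segment[s /andP[s0 s1] [kV kW]].
set k := xi0 + _ in kV kW.
have [v vV] : exists v, v \in V.
  by have [v vV _] := seq_argmax (dot k) V0; exists v.
have [w wW] : exists w, w \in W.
  by have [w wW _] := seq_argmax (dot k) W0; exists w.
have Dk zeta r : D (zeta + r *: k) = D zeta + r * (dot k v - dot k w).
  rewrite /D (@sup_constant _ _ _ v) ?(@sup_constant _ _ _ w) //.
  - by rewrite !dotZl; ring.
  - by move=> ? ? h1 h2; rewrite !dotZl (kW _ _ h1 h2).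
  - by move=> ? ? h1 h2; rewrite !dotZl (kV _ _ h1 h2).
(* [D] vanishes both at [xi0] and a little further along [k], so its slope along [k] is 0. *)
have kvw : dot k v - dot k w = 0.
  have [e ep eP] := near0_ex (D_near0 k).
  have := eP e; rewrite gtr0_norm // => /(_ (lexx _)).
  have := eP 0; rewrite normr0 scale0r addr0 => /(_ (ltW ep)).
  rewrite Dk => -> /eqP; rewrite add0r mulf_eq0 gt_eqF //= => /eqP//.
have DZ r zeta : 0 <= r -> D (r *: zeta) = r * D zeta.
  by move=> r0; rewrite /D !sup_scale // mulrBr.
exists ((1 - s) / s); first by rewrite divr_gt0 //; lra.
have := DZ s xi (ltW s0).
have -> : s *: xi = (1 - s) *: (- xi0) + 1 *: k.
  by apply/rowP => j; rewrite !mxE; ring.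
rewrite Dk kvw mulr0 addr0 DZ; last by lra.
by move=> h; rewrite mulrAC h mulrAC divff ?mul1r // gt_eqF.
Qed.

(** Wherever [D] is nonzero it has the sign of [D (- xi0)]; a generator outside the other hull would
    give a direction of the opposite sign. *)
Lemma hull_comparable :
  (forall v, v \in V -> hull W v) \/ (forall w, w \in W -> hull V w).
Proof.
have [h|h] := leP (D (- xi0)) 0; [left=> v vV | right=> w wW];
  apply: contrapT => /separation[xi xiP].
  have [[w wW wxi] _] := supP xi W0.
  have Dp : 0 < D xi.
    by rewrite subr_gt0 -wxi (lt_le_trans (xiP _ wW)) // sup_ge.
  have [|r r0 Dr] := @D_opposite xi; first by rewrite gt_eqF.
  by move: Dp; rewrite Dr pmulr_rgt0 // ltNge h.
have [[v vV vxi] _] := supP xi V0.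
have Dp : D xi < 0.
  by rewrite subr_lt0 -vxi (lt_le_trans (xiP _ vV)) // sup_ge.
have [|r r0 Dr] := @D_opposite xi; first by rewrite lt_eqF.
by move: Dp; rewrite Dr pmulr_rlt0 // ltNge ltW.
Qed.

End Comparison.
End Support.

(** * Reconstruction over the rationals *)

Section Reconstruction.
Variable d : nat.
Implicit Types (x y xi : 'rV[rat]_d) (V W : seq 'rV[rat]_d) (u z : 'rV[int]_d).

Lemma lat_finite V x : finite_set (lat V x).
Proof.
have [Z ZP] := lat_fset V x 0.
apply: sub_finite_set (finite_fset Z) => z h; apply: (ZP 0); rewrite ?addr0 //.
by move=> j; rewrite mxE normr0.
Qed.

Lemma latN_shift W u x : latN [seq w + zq u | w <- W] x = latN W x.
Proof.
rewrite /latN; have -> : lat [seq w + zq u | w <- W] x = [set z + u | z in lat W x]%classic.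
  apply/seteqP; split=> z /=.
    move/hull_translateE => h; exists (z - u); rewrite ?subrK //.
    by rewrite /lat /= zqD zqN addrAC.
  case=> z' h <-; apply/hull_translateE.
  by rewrite zqD addrAC addrK.
rewrite fset_set_image; last exact: lat_finite.
by rewrite card_imfset //; apply: addIr.
Qed.

Lemma per_eq_shift V W u : per_eq V W -> per_eq V [seq w + zq u | w <- W].
Proof. by move=> VW x; rewrite latN_shift VW. Qed.

(** At base point [v] the lattice set of [W] lies in that of [V] and has the same finite size, so
    both contain 0. *)
Lemma per_eq_sub V W : per_eq V W -> (forall w, w \in W -> hull V w) ->
  forall v, v \in V -> hull W v.
Proof.
move=> VW WV v vV.
have sub : (fset_set (lat W v) `<=` fset_set (lat V v))%fset.
  apply/fsubsetP => z; rewrite !in_fset_set ?inE; try exact: lat_finite.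
  exact: hull_sub.
have /eqP E : fset_set (lat W v) == fset_set (lat V v).
  by rewrite eqEfcard sub -/(latN V v) VW leqnn.
have : lat W v 0.
  rewrite (fset_set_inj (lat_finite W v) (lat_finite V v) E) /lat /= zq0 add0r.
  exact: hull_mem.
by rewrite /lat /= zq0 add0r.
Qed.

Lemma per_eq_comparable V W : per_eq V W ->
  (forall v, v \in V -> hull W v) \/ (forall w, w \in W -> hull V w) ->
  forall x, hull V x <-> hull W x.
Proof.
move=> VW h; have [h1 h2] : (forall v, v \in V -> hull W v) /\
    (forall w, w \in W -> hull V w).
  case: h => h; split=> //; last exact: per_eq_sub h.
  by apply: per_eq_sub h => x; rewrite VW.
by split; apply: hull_sub.
Qed.

Lemma size_face V xi : ~ constant_on V xi -> (size (face V xi) < size V)%N.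
Proof.
move=> nc; rewrite size_filter ltn_neqAle count_size andbT -all_count.
apply/negP => /allP h; apply: nc => v v' vV v'V; apply/eqP.
by rewrite eq_le (allP (h _ v'V)) // (allP (h _ vV)).
Qed.

Lemma size_face_le V xi : (size (face V xi) <= size V)%N.
Proof. by rewrite size_filter count_size. Qed.

(** Induction on the total number of generators: in a direction not constant on both lists, at least
    one face is strictly shorter. *)
Lemma per_eq_hull_shift V W : V != [::] -> W != [::] -> per_eq V W ->
  exists u, hull_shift V W (zq u).
Proof.
have [n] := ubnP (size V + size W)%N; elim: n V W => // n IH V W sVW V0 W0 VW.
suff [u h] : exists u, (forall v, v \in V -> hull [seq w + zq u | w <- W] v) \/
    (forall w, w \in [seq w + zq u | w <- W] -> hull V w).
  exists u => x; rewrite (per_eq_comparable (per_eq_shift u VW) h).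
  by rewrite (propext (hull_translateE _ _ _)) addrK.
(* [W'] is kept general because this is applied to [W], to find the shift, and then to the shifted
   list. *)
have IHf xi W' : size W' = size W -> W' != [::] -> per_eq V W' ->
    ~ (constant_on V xi /\ constant_on W' xi) ->
    exists u, hull_shift (face V xi) (face W' xi) (zq u).
  move=> sW' W'0 VW' nc; apply: IH; rewrite ?face_neq0 //; last exact: per_eq_face.
  move: sVW; rewrite ltnS -sW' => /(leq_trans _); apply.
  have [cV|/size_face sV] := pselect (constant_on V xi).
    have [cW|/size_face sW] := pselect (constant_on W' xi); first by case: nc.
    by rewrite -addnS leq_add ?size_face_le.
  by rewrite -addSn leq_add ?size_face_le.
have [[xi0 nc]|c] := pselect (exists xi, ~ (constant_on V xi /\ constant_on W xi)).
  have [u fu] := IHf xi0 W erefl W0 VW nc.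
  exists u; apply: (@hull_comparable _ _ _ _ xi0) => //.
  - by case: (W) W0.
  - move=> xi nc'; have [||||u' h] := @IHf xi [seq w + zq u | w <- W].
    + by rewrite size_map.
    + by case: (W) W0.
    + exact: per_eq_shift.
    + exact: nc'.
    by exists (zq u').
  - exact: hull_shift_face.
(* If all functionals are constant on both lists, [V] consists of copies of one point, and a lattice
   translate of it lies in the hull of [W]. *)
have cV v v' : v \in V -> v' \in V -> v = v'.
  move=> vV v'V; apply/rowP => j; rewrite -!(dot_delta j).
  have [cV _] : constant_on V (delta_mx 0 j) /\ constant_on W (delta_mx 0 j).
    by apply: contrapT => h; apply: c; exists (delta_mx 0 j).
  exact: cV.
have [v vV] : exists v, v \in V.
  by have [v vV _] := seq_argmax (fun=> 0 : rat) V0; exists v.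
have latV : 0%R \in fset_set (lat V v).
  rewrite in_fset_set ?inE; last exact: lat_finite.
  by rewrite /lat /= zq0 add0r; apply: hull_mem.
have [z] : exists z, z \in fset_set (lat W v).
  apply/fset0Pn; rewrite -cardfs_gt0 -/(latN W v) -VW cardfs_gt0.
  by apply/fset0Pn; exists 0.
rewrite in_fset_set ?inE => [Wz|]; last exact: lat_finite.
exists (- z); left=> v' v'V; rewrite (cV v' v) //; apply/hull_translateE.
by rewrite zqN opprK addrC.
Qed.

End Reconstruction.

(** * Passage to the real polytopes *)

Section Transfer.
Variables (R : realType) (d : nat).

(** If a weighted average were separated from the generators, a sum of weights times strictly
    positive gaps would vanish, forcing all weights to be 0. *)
Lemma convE (V : seq 'rV[R]_d) x : conv V x <-> hull V x.
Proof.
split=> [[w [w0 [w1 xE]]]|].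
  apply: contrapT => /separation[xi xiP].
  have dotx : dot xi x = \sum_(i < size V) w i * dot xi V`_i.
    rewrite xE; elim/big_rec2: _ => [|i a b _ <-]; first by rewrite dot0r.
    by rewrite dotDr dotZr.
  have : \sum_(i < size V) w i * (dot xi x - dot xi V`_i) = 0.
    under eq_bigr do rewrite mulrBr.
    by rewrite big_split /= sumrN -mulr_suml w1 mul1r -dotx subrr.
  have ge0 (i : 'I_(size V)) : 0 <= w i * (dot xi x - dot xi V`_i).
    by rewrite mulr_ge0 // subr_ge0 ltW // xiP // mem_nth.
  move/eqP; rewrite psumr_eq0 // => /allP h.
  have : \sum_(i < size V) w i = 0.
    apply: big1 => i _; have := h i (mem_index_enum _).
    by rewrite mulf_eq0 subr_eq0 (gt_eqF (xiP _ (mem_nth _ _))) // orbF => /eqP.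
  by rewrite w1 => /eqP; rewrite oner_eq0.
elim=> [v vV|t y z t0 t1 _ [w [w0 [w1 ->]]] _ [w' [w'0 [w'1 ->]]]].
  have iV : (index v V < size V)%N by rewrite index_mem.
  exists (fun i => (i == Ordinal iV)%:R); split; first by move=> i; rewrite ler0n.
  split; first by rewrite (bigD1 (Ordinal iV)) //= eqxx big1 ?addr0 // => i /negbTE->.
  rewrite (bigD1 (Ordinal iV)) //= eqxx scale1r nth_index // big1 ?addr0 // => i /negbTE->.
  by rewrite scale0r.
exists (fun i => t * w i + (1 - t) * w' i); split.
  by move=> i; rewrite addr_ge0 ?mulr_ge0 // subr_ge0.
split; first by rewrite big_split /= -!mulr_sumr w1 w'1 !mulr1 addrC subrK.
rewrite !scaler_sumr -big_split; apply: eq_bigr => i _.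
by rewrite /= [in RHS]scalerDl !scalerA.
Qed.

Definition realify (x : 'rV[rat]_d) : 'rV[R]_d := map_mx ratr x.

Lemma realify_dot x y : dot (realify x) (realify y) = ratr (dot x y) :> R.
Proof. by rewrite rmorph_sum; apply: eq_bigr => j _; rewrite !mxE rmorphM. Qed.

Lemma realifyD x y : realify (x + y) = realify x + realify y.
Proof. by apply/rowP => j; rewrite !mxE rmorphD. Qed.

Lemma realifyN x : realify (- x) = - realify x.
Proof. by apply/rowP => j; rewrite !mxE rmorphN. Qed.

Lemma realify_zq (z : 'rV[int]_d) : realify (zq z) = map_mx intr z.
Proof. by apply/rowP => j; rewrite !mxE ratr_int. Qed.

(** A rational point outside the rational hull has a rational separating functional, which still
    separates over the reals. *)
Lemma realify_hull V x : hull (map realify V) (realify x) <-> hull V x.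
Proof.
split=> [h|]; last first.
  elim=> [v vV|t y z t0 t1 _ hy _ hz]; first by apply/hull_mem/map_f.
  have -> : realify (t *: y + (1 - t) *: z) =
      ratr t *: realify y + (1 - ratr t) *: realify z.
    by apply/rowP => j; rewrite !mxE rmorphD !rmorphM rmorphB rmorph1.
  by apply: hull_conv => //; rewrite -?(rmorph0 (@ratr R)) -?(rmorph1 (@ratr R)) ler_rat.
apply: contrapT => /separation[xi xiP].
have : dot (realify xi) (realify x) < ratr (dot xi x).
  by apply: hull_lt h => _ /mapP[v vV ->]; rewrite realify_dot ltr_rat xiP.
by rewrite realify_dot ltxx.
Qed.

(** Full dimension provides a point of [X], hence a generator. *)
Lemma rational_vertices (X : set 'rV[R]_d) : rational_dpolytope X ->
  exists2 V : seq 'rV[rat]_d, V != [::] & X = conv (map realify V).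
Proof.
case=> [[U [Urat XE]] [c [e [e0 ce]]]].
have [V VE] : exists V : seq 'rV[rat]_d, U = map realify V.
  elim: U Urat {XE} => [|x U IH] Urat; first by exists [::].
  have [V ->] : exists V : seq 'rV[rat]_d, U = map realify V.
    by apply: IH => y yU; apply: Urat; rewrite inE yU orbT.
  have [q ->] := Urat x (mem_head _ _); by exists (q :: V).
exists V; last by rewrite XE VE.
have : X c by apply: ce => i; rewrite subrr normr0.
rewrite XE VE => /convE/hull_exists[v /mapP[q qV _]].
by case: V qV {VE}.
Qed.

(** An integer point z lies in P - x exactly when z + x lies in P, which explains the sign. *)
Lemma ehr_latN V x :
  ehr (translate (conv (map realify V)) (realify (- x))) 1 = latN V (x : 'rV[rat]_d).
Proof.
rewrite /ehr /latN.
congr (size (enum_fset (fset_set _))); apply/seteqP; split=> z.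
  case=> _ [y /convE Vy <-] /=; rewrite scale1r realifyN => yz.
  by apply/realify_hull; rewrite realifyD realify_zq -yz subrK.
move/realify_hull/convE => Vz; exists (map_mx intr z); last by rewrite scale1r.
by exists (realify (zq z + x)); rewrite // realifyD realify_zq realifyN addrK.
Qed.

End Transfer.

Theorem theorem1p4 (R : realType) (d : nat) (P Q : set 'rV[R]_d) :
  rational_dpolytope P -> rational_dpolytope Q ->
  (forall v : 'rV[R]_d, rat_point v ->
     forall t : nat, ehr (translate P v) t = ehr (translate Q v) t) ->
  exists u : 'rV[R]_d, lattice_point u /\ P = translate Q u.
Proof.
move=> /rational_vertices[V V0 ->] /rational_vertices[W W0 ->] PQ.
have [u uP] : exists u : 'rV[int]_d, hull_shift V W (zq u).
  apply: per_eq_hull_shift => // x; rewrite -!(@ehr_latN R); apply: PQ.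
  by exists (- x).
exists (realify R (zq u)); split; first by exists u; apply: realify_zq.
apply/seteqP; split=> x.
  (* The point [x] may be irrational, so membership is transferred at the rational generators
     only. *)
  move/convE => Vx; exists (x - realify R (zq u)); last by rewrite subrK.
  apply/convE/hull_translateE; apply: hull_sub Vx => _ /mapP[v vV ->].
  have Wv : hull W (v - zq u) by apply/uP; rewrite subrK; apply: hull_mem.
  apply/hull_translateE; rewrite -[v](subrK (zq u)) realifyD addrK.
  exact/realify_hull.
case=> y /convE Wy <-; apply/convE.
have {Wy} : hull [seq w + realify R (zq u) | w <- map (@realify R d) W] (y + realify R (zq u)).
  exact: hull_translate.
apply: hull_sub => _ /mapP[_ /mapP[w wW ->] ->].
by rewrite -realifyD; apply/realify_hull/uP/hull_mem.
Qed.
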